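(* Let $d\geq 3$ be a natural number. There is a relational signature $\sigma_d$ and a sequence $(\phi_h)_{h\geq1}$ of first-order sentences over $\sigma_d$ of size $O(h)$ such that for each $h\geq1$, every sentence in Barthelmann-Schwentick normal form that is equivalent to $\phi_h$ on all $\sigma_d$-structures of degree $\leq d$ has size $>2^{(d-1)^{2^h}}$.
   Context: Structures are finite with non-empty universe; the degree of a structure is the maximum degree of its Gaifman graph (vertices the elements, edges between distinct elements occurring together in some tuple of some relation). The size of a formula is its length as a word. A formula $\phi(\overline{y},z)$ is $r$-local around $z$ if for every structure $\mathcal{A}$ and all tuples, $\mathcal{A}\models\phi[\overline{a},c]$ iff $\mathcal{A}[\{\text{entries of }\overline{a}\}\cup N_r^{\mathcal{A}}(c)]\models\phi[\overline{a},c]$, where $N_r^{\mathcal{A}}(c)$ is the set of elements at Gaifman distance $\leq r$ from $c$. A sentence is in Barthelmann-Schwentick normal form if it has the form $\exists y_1\cdots\exists y_n\forall z\,\phi(y_1,\dots,y_n,z)$ with $n\ge0$ and $\phi$ $r$-local around $z$ for some $r\geq0$. *)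

(* Defs.v *)
From mathcomp Require Import all_boot.

Set Implicit Arguments.
Unset Strict Implicit.
Unset Printing Implicit Defensive.

Record signature := Signature {
  rel_symbol : finType;
  arity : rel_symbol -> nat;
  arity_gt0 : forall R, 0 < arity R
}.

Record structure (sigma : signature) := Structure {
  universe :> finType;
  universe_nonempty : 0 < #|universe|;
  interp : forall R : rel_symbol sigma, pred ((arity R).-tuple universe)
}.

Section Gaifman.
Variables (sigma : signature) (A : structure sigma).

Definition gaifman (x y : A) : bool :=
  (x != y) && [exists R : rel_symbol sigma, exists t : (arity R).-tuple A,
                 [&& interp t, x \in t & y \in t]].

Definition degree : nat := \max_(x : A) #|[set y : A | gaifman x y]|.

(* The elements reached from c by a walk of at most r edges, [p] being the
   list of the vertices of the walk after c. *)
Definition ball (r : nat) (c : A) : {set A} :=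
  [set x | [exists p : r.-bseq A, path gaifman c p && (last c p == x)]].

Lemma ball_center r c : c \in ball r c.
Proof. by rewrite inE; apply/existsP; exists [bseq] => /=. Qed.

Lemma card_induced_gt0 (X : {set A}) : X != set0 -> 0 < #|{: {x : A | x \in X}}|.
Proof. by rewrite card_sig -card_gt0. Qed.

Definition induced (X : {set A}) (X0 : X != set0) : structure sigma :=
  @Structure sigma {x : A | x \in X} (card_induced_gt0 X0)
    (fun R t => interp (map_tuple val t)).

End Gaifman.

(* Variables are natural numbers. *)
Inductive formula (sigma : signature) : Type :=
| Eq of nat & nat
| Rel (R : rel_symbol sigma) of (arity R).-tuple nat
| Not of formula sigma
| And of formula sigma & formula sigma
| Or of formula sigma & formula sigma
| Imp of formula sigma & formula sigma
| Iff of formula sigma & formula sigma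
| Ex of nat & formula sigma
| All of nat & formula sigma.

Arguments Eq {sigma}.

(* Each variable and each relation symbol is a single letter. *)
Inductive letter (sigma : signature) : Type :=
| LVar of nat
| LRel of rel_symbol sigma
| LEq | LNot | LAnd | LOr | LImp | LIff | LEx | LAll
| LOpen | LClose | LComma.

Arguments LVar {sigma}.
Arguments LEq {sigma}.
Arguments LNot {sigma}.
Arguments LAnd {sigma}.
Arguments LOr {sigma}.
Arguments LImp {sigma}.
Arguments LIff {sigma}.
Arguments LEx {sigma}.
Arguments LAll {sigma}.
Arguments LOpen {sigma}.
Arguments LClose {sigma}.
Arguments LComma {sigma}.

Fixpoint comma_sep (sigma : signature) (xs : seq nat) : seq (letter sigma) :=
  match xs with
  | [::] => [::]
  | [:: x] => [:: LVar x]
  | x :: xs' => [:: LVar x, LComma & comma_sep sigma xs']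
  end.

Fixpoint word (sigma : signature) (f : formula sigma) : seq (letter sigma) :=
  let binary l g h := LOpen :: word g ++ l :: word h ++ [:: LClose] in
  match f with
  | Eq x y => [:: LVar x; LEq; LVar y]
  | Rel R t => [:: LRel R, LOpen & comma_sep sigma t ++ [:: LClose]]
  | Not g => LNot :: word g
  | And g h => binary LAnd g h
  | Or g h => binary LOr g h
  | Imp g h => binary LImp g h
  | Iff g h => binary LIff g h
  | Ex x g => [:: LEx, LVar x & word g]
  | All x g => [:: LAll, LVar x & word g]
  end.

Definition formula_size (sigma : signature) (f : formula sigma) : nat :=
  size (word f).

Fixpoint free_vars (sigma : signature) (f : formula sigma) : seq nat :=
  match f with
  | Eq x y => [:: x; y]
  | Rel R t => t
  | Not g => free_vars g
  | And g h | Or g h | Imp g h | Iff g h => free_vars g ++ free_vars h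
  | Ex x g | All x g => [seq y <- free_vars g | y != x]
  end.

Definition sentence (sigma : signature) (f : formula sigma) : Prop :=
  free_vars f = [::].

Definition upd (T : Type) (v : nat -> T) (x : nat) (a : T) : nat -> T :=
  fun y => if y == x then a else v y.

Fixpoint sat (sigma : signature) (A : structure sigma) (v : nat -> A)
    (f : formula sigma) : Prop :=
  match f with
  | Eq x y => v x = v y
  | Rel R t => interp (map_tuple v t)
  | Not g => ~ sat v g
  | And g h => sat v g /\ sat v h
  | Or g h => sat v g \/ sat v h
  | Imp g h => sat v g -> sat v h
  | Iff g h => sat v g <-> sat v h
  | Ex x g => exists a : A, sat (upd v x a) g
  | All x g => forall a : A, sat (upd v x a) g
  end.

(* Meant for sentences, whose truth value does not depend on [v]; the universe
   is non-empty, so the quantification over [v] is never vacuous. *)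
Definition models (sigma : signature) (A : structure sigma)
    (f : formula sigma) : Prop :=
  forall v : nat -> A, sat v f.

Definition equiv_upto_degree (sigma : signature) (d : nat)
    (f g : formula sigma) : Prop :=
  forall A : structure sigma, degree A <= d -> (models A f <-> models A g).

Section Locality.
Variables (sigma : signature) (A : structure sigma).
Variables (r : nat) (ys : seq nat) (z : nat) (v : nat -> A).

Definition local_set : {set A} :=
  [set a in [seq v y | y <- ys]] :|: ball r (v z).

Lemma local_set_neq0 : local_set != set0.
Proof. by apply/set0Pn; exists (v z); rewrite inE ball_center orbT. Qed.

Definition local_structure : structure sigma := induced local_set_neq0.

End Locality.

(* The tuple (a_1, ..., a_n, c) is given as the values of an assignment [v] at
   the variables [ys] and [z]; [w] represents the same tuple in the induced
   substructure. *)
Definition local_around (sigma : signature) (r : nat) (ys : seq nat) (z : nat)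
    (f : formula sigma) : Prop :=
  forall (A : structure sigma) (v : nat -> A)
         (w : nat -> local_structure r ys z v),
    (forall x, x \in rcons ys z -> val (w x) = v x) ->
    (sat v f <-> sat w f).

Definition BS_normal_form (sigma : signature) (psi : formula sigma) : Prop :=
  exists (ys : seq nat) (z : nat) (f : formula sigma) (r : nat),
    [/\ uniq (rcons ys z),
        {subset free_vars f <= rcons ys z},
        local_around r ys z f
      & psi = foldr (@Ex sigma) (All z f) ys].

(* Main.v *)
(** Let [k := d - 1] and [H := 2 ^ h].  The sentence [phi h] says that every
    rooted [k]-ary tree of height [H] whose leaves carry a bit has, for each
    leaf, a companion tree whose labelling differs at that leaf only.  Leaves of
    two trees are matched by an [O(h)]-size formula "[z] and [z'] are reached
    from [x] and [x'] by the same word of length [2 ^ h]", obtained by halving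
    the word and universally quantifying over the two halves.  The disjoint union
    of all [2 ^ (k ^ H)] labelled trees has degree at most [d] and satisfies
    [phi h]; deleting any one tree falsifies it.  A sentence
    [exists ys, forall z, f] with [f] local around [z] stays true when a
    component without witness is deleted, so it needs a witness in each tree. *)

Require Import Defs.
From mathcomp Require Import all_boot.
From mathcomp Require Import zify.

Set Implicit Arguments.
Unset Strict Implicit.
Unset Printing Implicit Defensive.

(** * Normal forms and deletion of components *)

(** Agreement is asked on the free variables only, so that the case [e = id] is the coincidence
    lemma [sat_eq_in]. *)
Lemma sat_iso (sigma : signature) (A B : structure sigma) (e : A -> B)
    (f : formula sigma) (v : nat -> A) (w : nat -> B) :
    injective e -> (forall b, exists a, e a = b) ->
    (forall (R : rel_symbol sigma) (t : (arity R).-tuple A),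
        interp (map_tuple e t) = interp t) ->
    {in free_vars f, forall x, w x = e (v x)} ->
  sat v f <-> sat w f.
Proof.
move=> e_inj e_surj eR.
have upd_e (g : formula sigma) x u u' a : {in [seq y <- free_vars g | y != x],
    forall y, u' y = e (u y)} ->
    {in free_vars g, forall y, upd u' x (e a) y = e (upd u x a y)}.
  move=> uu' y gy; rewrite /upd; case: eqVneq => // yx.
  by apply: uu'; rewrite mem_filter yx.
have catl (g g' : formula sigma) u u' : {in free_vars g ++ free_vars g',
    forall y, u' y = e (u y)} -> {in free_vars g, forall y, u' y = e (u y)}.
  by move=> uu' y gy; apply: uu'; rewrite mem_cat gy.
have catr (g g' : formula sigma) u u' : {in free_vars g ++ free_vars g',
    forall y, u' y = e (u y)} -> {in free_vars g', forall y, u' y = e (u y)}.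
  by move=> uu' y gy; apply: uu'; rewrite mem_cat gy orbT.
elim: f v w => [x y|R t|g IH|g IHg g' IHg'|g IHg g' IHg'|g IHg g' IHg'
  |g IHg g' IHg'|x g IH|x g IH] v w /= vw.
- rewrite !vw ?inE ?eqxx ?orbT //; split=> [->//|]; exact: e_inj.
- rewrite -eR; suff -> : map_tuple e (map_tuple v t) = map_tuple w t by [].
  apply: val_inj => /=; rewrite -map_comp; apply/eq_in_map => y ty /=.
  by rewrite vw.
- by have := IH _ _ vw; tauto.
- by have := IHg _ _ (catl _ _ _ _ vw); have := IHg' _ _ (catr _ _ _ _ vw); tauto.
- by have := IHg _ _ (catl _ _ _ _ vw); have := IHg' _ _ (catr _ _ _ _ vw); tauto.
- by have := IHg _ _ (catl _ _ _ _ vw); have := IHg' _ _ (catr _ _ _ _ vw); tauto.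
- by have := IHg _ _ (catl _ _ _ _ vw); have := IHg' _ _ (catr _ _ _ _ vw); tauto.
- split=> [[a sa]|[b sb]].
    by exists (e a); apply: (proj1 (IH _ _ (upd_e _ _ _ _ a vw))).
  have [a ab] := e_surj b; exists a; rewrite -ab in sb.
  exact: (proj2 (IH _ _ (upd_e _ _ _ _ a vw))).
- split=> sv b; last exact: (proj2 (IH _ _ (upd_e _ _ _ _ b vw))).
  by have [a <-] := e_surj b; apply: (proj1 (IH _ _ (upd_e _ _ _ _ a vw))).
Qed.

Lemma sat_eq_in (sigma : signature) (A : structure sigma) (f : formula sigma)
    (v w : nat -> A) : {in free_vars f, w =1 v} -> sat v f <-> sat w f.
Proof.
apply: (@sat_iso _ _ _ id) => // [b|R t]; first by exists b.
by congr interp; apply: val_inj; rewrite /= map_id.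
Qed.

Lemma sat_foldr_Ex (sigma : signature) (A : structure sigma)
    (g : formula sigma) (ys : seq nat) (v : nat -> A) :
  sat v (foldr (@Ex sigma) g ys) <->
  exists2 w : nat -> A, forall x, x \notin ys -> w x = v x & sat w g.
Proof.
elim: ys v => [|y ys IH] v /=.
  split=> [sg|[w wv]]; first by exists v.
  by apply: (proj2 (sat_eq_in _)) => x _; apply: wv.
split=> [[a /IH[w wv sg]]|[w wv sg]].
  exists w => // x; rewrite inE negb_or => /andP[xy xys].
  by rewrite wv // /upd (negPf xy).
exists (w y); apply/IH; exists w => // x xys; rewrite /upd.
by case: eqVneq => [->//|xy]; rewrite wv // inE negb_or xy.
Qed.

Lemma ballP (sigma : signature) (A : structure sigma) (r : nat) (c x : A) :
  reflect (exists p, [/\ size p <= r, path (@gaifman _ A) c p & last c p = x])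
          (x \in ball r c).
Proof.
rewrite inE; apply: (iffP existsP) => [[p /andP[pp /eqP lx]]|[p [sp pp lx]]].
  by exists p; split; rewrite ?size_bseq.
by exists (Bseq sp); rewrite /= pp lx eqxx.
Qed.

(* [B] is, up to isomorphism, a union of connected components of [A]. *)
Record component_embedding (sigma : signature) (A B : structure sigma)
    (e : B -> A) : Prop := ComponentEmbedding {
  emb_inj : injective e;
  emb_interp : forall (R : rel_symbol sigma) (t : (arity R).-tuple B),
    interp (map_tuple e t) = interp t;
  emb_closed : forall (R : rel_symbol sigma) (t : (arity R).-tuple A) x y,
    interp t -> x \in t -> y \in t -> x \in codom e -> y \in codom e
}.

Section ComponentEmbedding.
Variables (sigma : signature) (A B : structure sigma) (e : B -> A).
Hypothesis emb : component_embedding e.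
Let e_inj := emb_inj emb.

Lemma gaifman_codom x y : gaifman (e x) y -> y \in codom e.
Proof.
case/andP=> _ /existsP[R /existsP[t /and3P[ti tx ty]]].
exact: (emb_closed emb ti tx ty (codom_f e x)).
Qed.

Lemma gaifman_emb x y : gaifman (e x) (e y) = gaifman x y.
Proof.
rewrite /gaifman (inj_eq e_inj); congr (_ && _); apply/existsP/existsP.
  move=> [R /existsP[t /and3P[ti tx ty]]]; exists R; apply/existsP.
  (* A left inverse of [e]; the default [x] is never reached on the entries of [t], which all lie in
     the image by closure. *)
  pose g a := odflt x [pick b | e b == a].
  have gK a : a \in t -> e (g a) = a.
    move=> ta; have /codomP[b ->] := emb_closed emb ti tx ta (codom_f e x).
    by rewrite /g; case: pickP => [b' /eqP//|/(_ b)]; rewrite eqxx.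
  have te : map_tuple e (map_tuple g t) = t.
    apply: val_inj; rewrite /= -map_comp -[RHS]map_id.
    by apply/eq_in_map => a /gK.
  exists (map_tuple g t); rewrite -(emb_interp emb) te ti /=.
  rewrite -(mem_map e_inj _ x) -(mem_map e_inj _ y).
  by have /(congr1 val) /= -> := te; rewrite tx ty.
move=> [R /existsP[t /and3P[ti tx ty]]]; exists R; apply/existsP.
by exists (map_tuple e t); rewrite (emb_interp emb) ti !map_f.
Qed.

Lemma path_emb (c : B) (p : seq A) : path (@gaifman _ A) (e c) p ->
  exists2 q, p = map e q & path (@gaifman _ B) c q.
Proof.
elim: p c => [|a p IH] c /=; first by exists [::].
case/andP=> ca; have /codomP[b ab] := gaifman_codom ca; rewrite {}ab in ca *.
move=> /IH[q -> pq]; exists (b :: q) => //=.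
by rewrite -gaifman_emb ca.
Qed.

(** A walk that starts in a union of components never leaves it, so it lifts along [e]. *)
Lemma ball_emb r c : ball r (e c) = e @: ball r c.
Proof.
apply/setP => a; apply/ballP/imsetP => [[p [sp pp <-]]|[b /ballP[p [sp pp <-]] ->]].
  have [q pq qq] := path_emb pp; exists (last c q); last by rewrite pq last_map.
  by apply/ballP; exists q; rewrite pq size_map in sp.
exists (map e p); rewrite size_map last_map; split=> //.
by rewrite path_map; apply: sub_path pp => x y; rewrite /= gaifman_emb.
Qed.

Lemma local_set_emb r ys z (v : nat -> B) :
  local_set r ys z (e \o v) = e @: local_set r ys z v.
Proof.
rewrite /local_set imsetU -ball_emb; congr (_ :|: _).
apply/setP=> a; rewrite inE; apply/mapP/imsetP => [[y yys ->]|[b]].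
  by exists (v y); rewrite ?inE ?map_f.
by rewrite inE => /mapP[y yys ->] ->; exists y.
Qed.

(** Locality moves both sides to the induced substructures on the local sets, and [e] restricts to
    an isomorphism between these. *)
Lemma local_sat_emb r ys z f (v : nat -> B) :
  local_around r ys z f -> sat (e \o v) f <-> sat v f.
Proof.
move=> loc.
have inLA (x : local_structure r ys z v) :
    e (val x) \in local_set r ys z (e \o v).
  by rewrite local_set_emb imset_f // (valP x).
pose h (x : local_structure r ys z v) : local_structure r ys z (e \o v) :=
  exist _ (e (val x)) (inLA x).
have zL : v z \in local_set r ys z v by rewrite inE ball_center orbT.
pose w x : local_structure r ys z v := insubd (exist _ (v z) zL) (v x).
have wv x : x \in rcons ys z -> val (w x) = v x.
  move=> xys; rewrite insubdK //; move: xys; rewrite mem_rcons inE.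
  case/predU1P => [->//|xys]; by apply/setUP; left; rewrite inE map_f.
rewrite (loc _ _ w wv) (loc _ (e \o v) (h \o w)) => [|x /wv /= ->//].
symmetry; apply: (@sat_iso _ _ _ h) => //.
- by move=> x y [] /e_inj /val_inj.
- move=> [a aL]; have := aL; rewrite {1}local_set_emb => /imsetP[b bL ab].
  by exists (exist _ b bL); apply: val_inj.
- move=> R t; rewrite /= -(emb_interp emb); congr interp; apply: val_inj.
  by rewrite /= -!map_comp.
Qed.

(** Restricting to a union of components that contains the witnesses only drops instances of the
    universal quantifier; by locality each remaining instance keeps its truth value. *)
Lemma models_component r ys z f (v : nat -> A) :
    {subset free_vars f <= rcons ys z} -> local_around r ys z f ->
    sat v (All z f) -> {in ys, forall y, v y \in codom e} ->
  models B (foldr (@Ex sigma) (All z f) ys).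
Proof.
move=> fv loc sv vys u; apply/sat_foldr_Ex.
pose g a := odflt (u 0) [pick b | e b == a].
exists (fun x => if x \in ys then g (v x) else u x) => [x /negPf->//|c].
apply/(local_sat_emb _ loc).
apply: (proj1 (sat_eq_in _)) (sv (e c)) => x /fv; rewrite mem_rcons inE /upd /=.
case: eqVneq => //= _ xys; rewrite xys; have /codomP[b ->] := vys _ xys.
by rewrite /g; case: pickP => [b' /eqP//|/(_ b)]; rewrite eqxx.
Qed.

End ComponentEmbedding.

(** * The sentences *)

Section Sentences.
Variable k : nat.

(* [inl i] is the [i]-th child relation, [inr true] marks roots and
   [inr false] marks the leaves labelled 1. *)
Definition tree_arity (R : 'I_k + bool) : nat := if R is inl _ then 2 else 1.

Lemma tree_arity_gt0 R : 0 < tree_arity R. Proof. by case: R. Qed.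

Definition tree_sig : signature := Signature tree_arity_gt0.

Definition child (i : 'I_k) (x y : nat) : formula tree_sig :=
  @Rel tree_sig (inl i) [tuple x; y].
Definition root (x : nat) : formula tree_sig :=
  @Rel tree_sig (inr true) [tuple x].
Definition label (x : nat) : formula tree_sig :=
  @Rel tree_sig (inr false) [tuple x].

(** [Not (Eq x x)] stands for the empty disjunction. The length depends on [k] alone. *)
Definition same_child (x x' y y' : nat) : formula tree_sig :=
  foldr (fun i g => Or (And (child i x y) (child i x' y')) g)
        (Not (Eq x x)) (enum 'I_k).

Definition Eq4 (x1 x2 x3 x4 y1 y2 y3 y4 : nat) : formula tree_sig :=
  And (And (Eq x1 y1) (Eq x2 y2)) (And (Eq x3 y3) (Eq x4 y4)).

(* The variables [2 + m] and [3 + m] are reached from [m] and [1 + m] by the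
   same word of length [2 ^ h].  Quantifying over both halves
   [(m, 1+m, 4+m, 5+m)] and [(4+m, 5+m, 2+m, 3+m)] keeps a single recursive
   occurrence. *)
Fixpoint same_word (h m : nat) : formula tree_sig :=
  if h is h'.+1 then
    Ex (4 + m) (Ex (5 + m)
      (All (6 + m) (All (7 + m) (All (8 + m) (All (9 + m)
        (Imp (Or (Eq4 (6 + m) (7 + m) (8 + m) (9 + m)
                      (0 + m) (1 + m) (4 + m) (5 + m))
                 (Eq4 (6 + m) (7 + m) (8 + m) (9 + m)
                      (4 + m) (5 + m) (2 + m) (3 + m)))
             (same_word h' (6 + m))))))))
  else same_child (0 + m) (1 + m) (2 + m) (3 + m).

(** Variables 0 and 1 are the roots, 2 and 3 the matched leaves, 4 the place to flip. Variable 4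
    ranges over all elements: in a forest, if it is no leaf below 0, the tree is its own
    companion. *)
Definition flip_closed (h : nat) : formula tree_sig :=
  All 0 (All 4 (Imp (root 0) (Ex 1 (And (root 1) (All 2 (All 3
    (Imp (same_word h 0) (Iff (Iff (label 2) (label 3)) (Not (Eq 2 4)))))))))).

Lemma mem_fvE (u : nat) :
  ((forall x g, (u \in free_vars (@Ex tree_sig x g)) = (u != x) && (u \in free_vars g))
  * (forall x g, (u \in free_vars (@All tree_sig x g)) = (u != x) && (u \in free_vars g))
  * (forall g g', (u \in free_vars (@And tree_sig g g'))
      = (u \in free_vars g) || (u \in free_vars g'))
  * (forall g g', (u \in free_vars (@Or tree_sig g g'))
      = (u \in free_vars g) || (u \in free_vars g'))
  * (forall g g', (u \in free_vars (@Imp tree_sig g g'))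
      = (u \in free_vars g) || (u \in free_vars g'))
  * (forall g g', (u \in free_vars (@Iff tree_sig g g'))
      = (u \in free_vars g) || (u \in free_vars g'))
  * (forall g, (u \in free_vars (@Not tree_sig g)) = (u \in free_vars g))
  * (forall x y, (u \in free_vars (@Eq tree_sig x y)) = (u == x) || (u == y))
  * (forall i x y, (u \in free_vars (child i x y)) = (u == x) || (u == y))
  * (forall x, (u \in free_vars (root x)) = (u == x))
  * (forall x, (u \in free_vars (label x)) = (u == x)))%type.
Proof.
by do ![split]; move=> *; rewrite /= ?mem_filter ?mem_cat ?inE.
Qed.

Lemma same_child_fv x x' y y' :
  {subset free_vars (same_child x x' y y') <= [:: x; x'; y; y']}.
Proof.
rewrite /same_child; elim: (enum _) => [|i s IH] u.
  by rewrite !mem_fvE !inE orbb => ->.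
have := IH u; rewrite [foldr _ _ _]/= !mem_fvE !inE.
case: (u \in free_vars _) => [/(_ isT)|_]; first by move->; rewrite ?orbT.
by do 4!case: (u == _).
Qed.

Lemma same_word_fv h m :
  {subset free_vars (same_word h m) <= [:: 0 + m; 1 + m; 2 + m; 3 + m]}.
Proof.
elim: h m => [|h IH] m u; first exact: same_child_fv.
have := IH (6 + m) u; cbn [same_word]; rewrite /Eq4 !mem_fvE !inE !addnA.
case: (u \in free_vars _) => [/(_ isT)|_].
  by case/or4P => /eqP->; rewrite ?eqxx ?andbF.
move=> /and5P[/negPf n4 /negPf n5 /negPf n6 /negPf n7 /and3P[/negPf n8 /negPf n9]].
by rewrite n4 n5 n6 n7 n8 n9 !orbF /=; do 4!case: (u == _).
Qed.

Lemma flip_closed_sentence h : sentence (flip_closed h).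
Proof.
rewrite /sentence; case E: (free_vars _) => [//|u s].
have : u \in free_vars (flip_closed h) by rewrite E mem_head.
have := @same_word_fv h 0 u; rewrite /flip_closed !mem_fvE !inE.
case: (u \in free_vars _) => [/(_ isT)|_].
  by case/or4P => /eqP->.
by do 5!case: (u == _).
Qed.

Lemma formula_sizeE :
  ((forall x g, formula_size (@Ex tree_sig x g) = (formula_size g).+2)
  * (forall x g, formula_size (@All tree_sig x g) = (formula_size g).+2)
  * (forall g g', formula_size (@And tree_sig g g')
      = (formula_size g + formula_size g').+3)
  * (forall g g', formula_size (@Or tree_sig g g')
      = (formula_size g + formula_size g').+3)
  * (forall g g', formula_size (@Imp tree_sig g g')
      = (formula_size g + formula_size g').+3)
  * (forall g g', formula_size (@Iff tree_sig g g')
      = (formula_size g + formula_size g').+3)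
  * (forall g, formula_size (@Not tree_sig g) = (formula_size g).+1)
  * (forall x y, formula_size (@Eq tree_sig x y) = 3)
  * (forall i x y, formula_size (child i x y) = 6)
  * (forall x, formula_size (root x) = 4)
  * (forall x, formula_size (label x) = 4))%type.
Proof.
by do ![split]; move=> *; rewrite /formula_size /= ?size_cat /= ?size_cat //=; lia.
Qed.

Lemma same_child_size : exists c, forall x x' y y',
  formula_size (same_child x x' y y') = c.
Proof.
rewrite /same_child; elim: (enum _) => [|i s [c IH]]; first by exists 4.
by exists (18 + c) => x x' y y'; rewrite [foldr _ _ _]/= !formula_sizeE IH.
Qed.

Lemma flip_closed_size :
  exists C, forall h, 1 <= h -> formula_size (flip_closed h) <= C * h.
Proof.
have [c sc] := same_child_size.
(* One halving costs 60 letters: 12 for six quantifiers, 6 for [Imp] and [Or], and 21 for each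
   [Eq4]. *)
have sw h m : formula_size (same_word h m) = c + 60 * h.
  elim: h m => [|h IH] m; first by rewrite muln0 addn0 sc.
  cbn [same_word]; rewrite /Eq4 !formula_sizeE IH; lia.
by exists (200 + c) => h h0; rewrite /flip_closed !formula_sizeE sw; nia.
Qed.

End Sentences.

(** * Forests of labelled trees *)

Section Forest.
Variables (k H : nat).

Definition labelling := {ffun H.-tuple 'I_k -> bool}.

Variables (F : finType) (F_gt0 : 0 < #|F|) (lab : F -> labelling).

(** A node is the index of its tree with its address, the word leading to it from the root; leaves
    have addresses of length [H]. The abstract index type [F] serves both the full forest and the
    forest with a tree deleted. *)
Definition node : Type := F * H.-bseq 'I_k.

Definition extends (w : seq 'I_k) (x y : node) : Prop :=
  x.1 = y.1 /\ y.2 = x.2 ++ w :> seq 'I_k.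

Definition node_label (x : node) : bool :=
  [exists t : H.-tuple 'I_k, (tval t == x.2) && lab x.1 t].

Definition forest_interp (R : 'I_k + bool) : pred ((tree_arity R).-tuple node) :=
  match R with
  | inl i => fun t => if tval t is [:: x; y] then
                        (x.1 == y.1) && (rcons x.2 i == y.2) else false
  | inr true => fun t => if tval t is [:: x] then x.2 == [bseq] else false
  | inr false => fun t => if tval t is [:: x] then node_label x else false
  end.

Lemma node_gt0 : 0 < #|{: F * H.-bseq 'I_k}|.
Proof. by rewrite card_prod muln_gt0 F_gt0; apply/card_gt0P; exists [bseq]. Qed.

Definition forest : structure (tree_sig k) :=
  @Structure (tree_sig k) _ node_gt0 forest_interp.

(** [None] yields the parent and [Some i] a child. For the degree bound the neighbours need only be
    among these [k + 1] values, so the spurious values at roots and leaves do no harm. *)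
Definition neighbour (x : forest) (o : option 'I_k) : forest :=
  (x.1, insubd ([bseq] : H.-bseq 'I_k)
         (if o is Some i then rcons x.2 i else rev (behead (rev x.2)))).

Lemma gaifman_neighbour (x y : forest) : gaifman x y -> y \in codom (neighbour x).
Proof.
case/andP=> xy /existsP[[i|b] /existsP[]]; last first.
  move=> [[|a [|? ?]] //= ?] /and3P[_]; rewrite !inE => /eqP xa /eqP ya.
  by rewrite xa ya eqxx in xy.
move=> [[|a [|b [|? ?]]] //= ?] /and3P[/andP[/eqP ab /eqP abi]].
rewrite !inE => /orP[]/eqP xE /orP[]/eqP yE; subst; rewrite ?eqxx // in xy *.
  apply/codomP; exists (Some i); rewrite /neighbour abi ab valKd.
  by case: (b).
apply/codomP; exists None; rewrite /neighbour -abi -ab rev_rcons /= revK valKd.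
by case: (a).
Qed.

Lemma forest_degree : degree forest <= k.+1.
Proof.
apply/bigmax_leqP => x _.
apply: leq_trans (_ : #|codom (neighbour x)| <= _).
  by apply/subset_leq_card/subsetP => y; rewrite inE => /gaifman_neighbour.
by apply: leq_trans (leq_image_card _ _) _; rewrite card_option card_ord.
Qed.

Lemma sat_same_child (v : nat -> forest) x x' y y' :
  sat v (same_child k x x' y y') <->
  exists i, extends [:: i] (v x) (v y) /\ extends [:: i] (v x') (v y').
Proof.
have childE i u u' : sat v (child i u u') <-> extends [:: i] (v u) (v u').
  rewrite /extends cats1 /=; split=> [/andP[/eqP-> /eqP->]//|[-> ->]].
  by rewrite !eqxx.
rewrite /same_child.
have -> : (exists i, extends [:: i] (v x) (v y) /\ extends [:: i] (v x') (v y'))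
  <-> exists2 i, i \in enum 'I_k &
        extends [:: i] (v x) (v y) /\ extends [:: i] (v x') (v y').
  by split=> [[i]|[i]]; exists i; rewrite ?mem_enum.
elim: (enum _) => [|i s IH]; first by split=> [/(_ erefl)|[]].
split=> [[[/childE xy /childE xy']|/IH[j js xy]]|[j]].
- by exists i; rewrite ?mem_head.
- by exists j; rewrite // inE js orbT.
rewrite inE => /predU1P[->[/childE ? /childE ?]|js xy]; first by left.
by right; apply/IH; exists j.
Qed.

Lemma updE (T : Type) (v : nat -> T) m i j a :
  upd v (i + m) a (j + m) = if j == i then a else v (j + m).
Proof. by rewrite /upd eqn_add2r. Qed.

(** The midpoint exists because prefixes of addresses are addresses; this justifies the halving in
    [same_word]. *)
Lemma extends_cat w w' (x y : node) :
  extends (w ++ w') x y <-> exists2 z, extends w x z & extends w' z y.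
Proof.
split=> [[xy yE]|[z [xz zE] [zy yE]]]; last first.
  by split; rewrite ?xz // yE zE catA.
have sz : size (x.2 ++ w) <= H.
  have := size_bseq y.2; rewrite yE !size_cat; lia.
by exists (x.1, Bseq sz); split=> //=; rewrite yE catA.
Qed.

Lemma sat_same_word h m (v : nat -> forest) :
  sat v (same_word k h m) <->
  exists w, [/\ size w = 2 ^ h, extends w (v (0 + m)) (v (2 + m))
              & extends w (v (1 + m)) (v (3 + m))].
Proof.
elim: h m v => [|h IH] m v.
  rewrite expn0; split=> [/sat_same_child[i [? ?]]|]; first by exists [:: i].
  move=> [[|i [|? ?]] [//= _ xy xy']].
  by apply/sat_same_child; exists i.
(* Restated by conversion so that all indices have the shape [j + m] required by [updE]. *)
have {}IH (u : nat -> forest) : sat u (same_word k h (6 + m)) <->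
  exists w, [/\ size w = 2 ^ h, extends w (u (6 + m)) (u (8 + m))
              & extends w (u (7 + m)) (u (9 + m))] := IH (6 + m) u.
rewrite expnS mul2n -addnn /=; split.
  move=> [z [z' sz]].
  (* Each disjunct of the guard, taken at its own quadruple, provides one half of the word. *)
  have := sz (v (0 + m)) (v (1 + m)) z z'.
  have := sz z z' (v (2 + m)) (v (3 + m)).
  rewrite !IH !updE /= => -[|w2 [sw2 zy zy']]; first by right.
  move=> [|w1 [sw1 xz xz']]; first by left.
  exists (w1 ++ w2); rewrite size_cat sw1 sw2; split=> //; apply/extends_cat.
    by exists z.
  by exists z'.
move=> [w [sw]]; rewrite -(cat_take_drop (2 ^ h) w).
move=> /extends_cat[z xz zy] /extends_cat[z' xz' zy'].
exists z, z' => a b c e; rewrite IH !updE /=.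
move=> [] [[-> ->] [-> ->]].
  by exists (take (2 ^ h) w); rewrite size_takel // sw leq_addr.
by exists (drop (2 ^ h) w); rewrite size_drop sw addnK.
Qed.

Lemma sat_flip_closed h (v : nat -> forest) :
  sat v (flip_closed k h) <->
  forall x y : node, x.2 = [bseq] -> exists2 x' : node, x'.2 = [bseq] &
    forall z z' w, size w = 2 ^ h -> extends w x z -> extends w x' z' ->
      ((node_label z <-> node_label z') <-> z <> y).
Proof.
rewrite /flip_closed; cbn [sat]; split=> sv x y.
  move=> /eqP x0; have [x' [x'0 sz]] := sv x y x0; exists x'; first exact/eqP.
  move=> z z' w sw xz xz'; apply: (sz z z'); apply/sat_same_word.
  by exists w.
move=> x0; have /eqP x_root : x.2 == [bseq] := x0.
have [x' /eqP x'0 sz] := sv x y x_root; exists x'; split=> // z z'.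
by move=> /sat_same_word[w [sw xz xz']]; apply: (sz z z' w).
Qed.

(** Since [H = 2 ^ h], the words of that length lead from a root exactly to the leaves of its tree.
    Hence only the set of labellings matters, and it has to be closed under flipping one bit. *)
Lemma models_flip_closed h : H = 2 ^ h ->
  models forest (flip_closed k h) <->
  forall f (t : H.-tuple 'I_k), exists g,
    forall s, lab g s = lab f s (+) (s == t).
Proof.
move=> HE.
have labelE (x : node) (s : H.-tuple 'I_k) :
    x.2 = s :> seq _ -> node_label x = lab x.1 s.
  move=> xs; apply/existsP/idP => [[u /andP[/eqP ux lu]]|ls].
    by have -> : s = u by apply: val_inj; rewrite /= ux.
  by exists s; rewrite xs eqxx.
have iffE (a b : bool) : (a <-> b) <-> (a = b).
  by split=> [ab|->//]; apply/idP/idP; apply ab.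
have size_t (s : H.-tuple 'I_k) : size s <= H by rewrite size_tuple.
split=> [fc f t|flip v].
  pose x : node := (f, [bseq]); pose leaf g s : node := (g, Bseq (size_t s)).
  have /sat_flip_closed/(_ x (leaf f t) erefl) := fc (fun _ => x).
  move=> [[g u] /= u0 sg]; exists g => s.
  have := sg (leaf f s) (leaf g s) s.
  rewrite size_tuple (labelE (leaf f s) s) // (labelE (leaf g s) s) //=.
  have -> : (leaf f s = leaf f t) <-> (s = t).
    by split=> [[st]|->//]; apply: val_inj.
  move=> /(_ HE); rewrite /extends /= u0 => /(_ (conj erefl erefl) (conj erefl erefl)).
  by rewrite iffE; case: (lab g s); case: (lab f s); case: eqP => /= st; intuition.
apply/sat_flip_closed => x y x0.
case: (boolP [exists t : H.-tuple 'I_k, (x.1 == y.1) && (tval t == y.2)]).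
  move=> /existsP[t /andP[/eqP xy /eqP ty]].
  have [g gE] := flip x.1 t; exists (g, [bseq]) => // z z' w /eqP sw.
  rewrite -HE in sw => -[xz zw] [gz' zw']; rewrite x0 /= in zw zw'.
  rewrite (labelE z (Tuple sw)) // (labelE z' (Tuple sw)) // -xz -gz' /= gE.
  have -> : (z = y) <-> (Tuple sw = t).
    split=> [zy|wt]; first by apply: val_inj; rewrite /= ty -zy zw.
    case: (z) (y) xz xy zw ty => [z1 z2] [y1 y2] /= <- <- zw ty.
    by congr pair; apply: val_inj; rewrite /= zw -ty -wt.
  by rewrite iffE; case: (lab _ _); case: eqP => /= st; intuition.
(* Here [y] is no leaf of the tree of [x], so nothing is to be flipped and [x] itself is the
   companion root. *)
move=> /existsP noty; exists x => // z z' w /eqP sw.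
rewrite -HE in sw => -[xz zw] [xz' zw']; rewrite x0 /= in zw zw'.
rewrite (labelE z (Tuple sw)) // (labelE z' (Tuple sw)) // -xz -xz'.
split=> // _ zy; apply: noty; exists (Tuple sw).
by rewrite -zy xz /= zw !eqxx.
Qed.

End Forest.

(** * Deleting one tree from the forest of all labelled trees *)

Section Deletion.
Variables (k H : nat) (t0 : labelling k H).

Let others : finType := {f : labelling k H | f != t0}.
Hypothesis others_gt0 : 0 < #|others|.
Hypothesis all_gt0 : 0 < #|labelling k H|.

Let full := forest all_gt0 id.
Let deleted := forest others_gt0 val.

Definition forget_deletion (x : deleted) : full := (val x.1, x.2).

Lemma codom_forget_deletion (x : full) :
  (x \in codom forget_deletion) = (x.1 != t0).
Proof.
apply/codomP/idP => [[[f u] ->]|]; first exact: (valP f).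
by case: x => f u /= ft; exists (exist _ f ft, u).
Qed.

(** No tuple of a relation meets two trees, so the remaining trees form a union of components. *)
Lemma forget_deletion_embedding : component_embedding forget_deletion.
Proof.
split.
- by move=> [f u] [g w] [/val_inj -> ->].
- move=> [i|[]].
  + by move=> [[|[f u] [|[g w] [|? ?]]] ?] //=.
  + by move=> [[|? [|? ?]] ?].
  + by move=> [[|? [|? ?]] ?].
- move=> R t x y ti tx ty; rewrite !codom_forget_deletion.
  suff -> : x.1 = y.1 by [].
  case: R t ti tx ty => [i|[]].
  + move=> [[|a [|b [|? ?]]] //= ?] /andP[/eqP ab _].
    by rewrite !inE => /orP[]/eqP-> /orP[]/eqP->.
  + by move=> [[|? [|? ?]] //= ?] _; rewrite !inE => /eqP-> /eqP->.
  + by move=> [[|? [|? ?]] //= ?] _; rewrite !inE => /eqP-> /eqP->.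
Qed.

End Deletion.

(** * The lower bound for normal forms *)

Lemma card_labelling k H : #|labelling k H| = 2 ^ (k ^ H).
Proof. by rewrite card_ffun card_bool card_tuple card_ord. Qed.

Lemma size_foldr_Ex (sigma : signature) (g : formula sigma) ys :
  formula_size (foldr (@Ex sigma) g ys) = 2 * size ys + formula_size g.
Proof. by elim: ys => //= y ys; rewrite /formula_size /= => ->; lia. Qed.

Lemma BS_size_gt k d h psi : 0 < k -> k < d ->
    BS_normal_form psi -> equiv_upto_degree d (flip_closed k h) psi ->
  2 ^ (k ^ (2 ^ h)) < formula_size psi.
Proof.
move=> k0 kd [ys [z [f [r [_ fv loc psiE]]]]] eqv.
set H := 2 ^ h; rewrite -(card_labelling k H).
have all_gt0 : 0 < #|labelling k H| by rewrite card_labelling expn_gt0.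
(* Each existential quantifier costs two letters, and the non-empty rest [All z f] makes the bound
   strict. *)
suff : #|labelling k H| <= size ys.
  rewrite psiE size_foldr_Ex /formula_size /=; lia.
rewrite leqNgt; apply/negP => few.
have dle F F0 lab : degree (@forest k H F F0 lab) <= d.
  exact: leq_trans (forest_degree _ _) kd.
have flip_full : models (forest all_gt0 id) (flip_closed k h).
  apply/models_flip_closed => // g t; exists [ffun s => g s (+) (s == t)] => s.
  by rewrite ffunE.
have /(_ (fun _ => (finfun (fun=> false), [bseq]))) := proj1 (eqv _ (dle _ _ _)) flip_full.
rewrite psiE => /sat_foldr_Ex[v _ sv].
(* Pigeonhole: with fewer witnesses than trees, some tree contains no witness. *)
have [t0 t0ys] : exists t0, t0 \notin [seq (v y).1 | y <- ys].
  apply/existsP; rewrite -negb_forall; apply/negP => /forallP all_in.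
  move: few; rewrite ltnNge -(size_map (fun y => (v y).1)) => /negP; apply.
  by rewrite cardE; apply: uniq_leq_size (enum_uniq _) _ => t _; apply: all_in.
pose s0 : H.-tuple 'I_k := [tuple of nseq H (Ordinal k0)].
(* This neighbour of [t0] survives the deletion, so the remaining forest is non-empty, but it loses
   its companion for the leaf [s0]. *)
pose f1 : labelling k H := [ffun s => t0 s (+) (s == s0)].
have f1t0 : f1 != t0.
  by apply/eqP => /ffunP/(_ s0); rewrite ffunE eqxx; case: (t0 s0).
have others_gt0 : 0 < #|{: {f : labelling k H | f != t0}}|.
  by apply/card_gt0P; exists (exist _ f1 f1t0).
have emb := forget_deletion_embedding others_gt0 all_gt0.
have ys_kept : {in ys, forall y,
    v y \in codom (@forget_deletion _ _ _ others_gt0 all_gt0)}.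
  move=> y yys; rewrite codom_forget_deletion.
  by apply: contraNneq t0ys => <-; apply: map_f.
have := models_component emb fv loc sv ys_kept; rewrite -psiE.
move=> /(proj2 (eqv _ (dle _ _ _))) /models_flip_closed.
(* Flipping [s0] in [f1] gives back [t0], the deleted labelling. *)
move=> /(_ erefl (exist _ f1 f1t0) s0) [[g gt0] /= gE].
case/negP: gt0; apply/eqP/ffunP => s.
by rewrite gE ffunE -addbA addbb addbF.
Qed.

Theorem theorem14 (d : nat) (hd : 3 <= d) :
  exists (sigma : signature) (phi : nat -> formula sigma),
    [/\ forall h : nat, 1 <= h -> sentence (phi h),
        exists C : nat, forall h : nat, 1 <= h -> formula_size (phi h) <= C * h
      & forall h : nat, 1 <= h ->
        forall psi : formula sigma,
          BS_normal_form psi ->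
          equiv_upto_degree d (phi h) psi ->
          2 ^ ((d - 1) ^ (2 ^ h)) < formula_size psi].
Proof.
exists (tree_sig (d - 1)), (flip_closed (d - 1)); split=> [h _||h _ psi nf].
- exact: flip_closed_sentence.
- exact: flip_closed_size.
- by apply: BS_size_gt nf; lia.
Qed.
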